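(* Let $\mathfrak{n}\in A_+$ and put $\lambda_{\mathfrak n}=\exp_{\mathbf C}(\tilde\pi/\mathfrak n)$. Then for every index $\mathbf{s}\in\mathbf{I}^{\mathrm{ext}}$, $$\lim_{\deg\mathfrak n\to\infty} H_{<\deg\mathfrak{n}}(\mathbf{s};\lambda_{\mathfrak{n}})=\zeta_A(\mathbf{s})\quad\text{in } \mathbb{C}_\infty .$$
   Context: Let $r$ be a power of a prime $p$, $A=\mathbb F_r[\theta]$, $K=\mathbb F_r(\theta)$, $K_\infty=\mathbb F_r((1/\theta))$, $\mathbb C_\infty$ the completion of an algebraic closure of $K_\infty$, with absolute value $|\cdot|_\infty$ normalized by $|\theta|_\infty=r$. $A_+$ is the set of monic polynomials, $A_{+,d}$ (resp. $A_{+,<d}$) the monic polynomials of degree $d$ (resp. $<d$). The Carlitz module is the $\mathbb F_r$-algebra map $a\mapsto \mathbf C_a(X)=\sum_{i=0}^{\deg a}[a,i]X^{r^i}\in A[X]$ determined by $\mathbf C_\theta(X)=\theta X+X^r$. The Carlitz exponential is $\exp_{\mathbf C}(X)=\sum_{i\ge0}X^{r^i}/D_i$ with $D_i=\prod_{j=0}^{i-1}(\theta^{r^i}-\theta^{r^j})$, and $\tilde\pi\in\mathbb C_\infty$ is the Carlitz period, so that $\ker\exp_{\mathbf C}=\tilde\pi A$; for $\mathfrak n\in A_+$, $\lambda_{\mathfrak n}$ generates the $A$-module $\{u:\mathbf C_{\mathfrak n}(u)=0\}$. The $u$-bracket of $a\in A$ is $[a]_u=\mathbf C_a(u)/u$ (equal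 to $a$ at $u=0$). Indices: $\mathbf I^{\mathrm{ext}}$ is the set of finite tuples of integers (including the empty tuple $\varnothing$). For $s,d\in\mathbb Z$, $S_d(s)=\sum_{a\in A_{+,d}}a^{-s}$ and $H_d(s;u)=\sum_{a\in A_{+,d}}[a]_u^{-s}$; for $\mathbf s=(s_1,\dots,s_m)\neq\varnothing$, $S_{<d}(\mathbf s)=\sum_{d>d_1>\cdots>d_m\ge0}\prod_j S_{d_j}(s_j)$ and $H_{<d}(\mathbf s;u)=\sum_{d>d_1>\cdots>d_m\ge0}\prod_j H_{d_j}(s_j;u)$, evaluated at any $u$ with $\mathbf C_a(u)\ne0$ for all $a\in A_{+,<d}$ (this holds for $u=\lambda_{\mathfrak n}$, $d=\deg\mathfrak n$); $S_{<d}(\varnothing)=H_{<d}(\varnothing;u)=1$. Thakur's multiple zeta value is $\zeta_A(\mathbf s)=\lim_{d\to\infty}S_{<d}(\mathbf s)\in K_\infty$ (this limit exists for all $\mathbf s\in\mathbf I^{\mathrm{ext}}$). Empty sums are $0$ and empty products are $1$. *)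

(* Defs.v *)
From HB Require Import structures.
From mathcomp Require Import all_boot all_order all_algebra.
From mathcomp Require Import all_fingroup all_solvable all_field.
From mathcomp Require Import qpoly.
From mathcomp Require Import all_classical all_reals all_analysis.
Set Implicit Arguments.
Unset Strict Implicit.
Unset Printing Implicit Defensive.
Import Order.TTheory GRing.Theory Num.Theory.
Import numFieldNormedType.Exports.
Local Open Scope classical_set_scope.
Local Open Scope ring_scope.

(* F is the finite field with r = #|F| elements, A = {poly F} and theta = 'X. *)

Section CarlitzModule.
Variable F : finFieldType.
Implicit Types a b : {poly F}.

Definition carlitz_theta : {poly {poly F}} := 'X *: 'X + 'X^#|F|.

(* By F-linearity C_a is the sum of the a_i C_(theta^i), and C_(theta^i) is the
   i-th iterate of C_theta; carlitzX, carlitzD, carlitzZ and carlitzM below say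
   that a |-> C_a is the F-algebra map, for the composition product, sending
   theta to theta X + X^r. *)
Definition carlitz a : {poly {poly F}} :=
  \sum_(i < size a) (a`_i)%:P *: iter i (fun P => carlitz_theta \Po P) 'X.

Lemma carlitz_widen n a : (size a <= n)%N -> carlitz a =
  \sum_(i < n) (a`_i)%:P *: iter i (fun P => carlitz_theta \Po P) 'X.
Proof.
move=> h; rewrite /carlitz.
rewrite (big_ord_widen n
  (fun i => (a`_i)%:P *: iter i (fun P => carlitz_theta \Po P) 'X) h).
rewrite big_mkcond; apply: eq_bigr => i _; case: ltnP => // hi.
by rewrite nth_default // scale0r.
Qed.

Lemma carlitzD a b : carlitz (a + b) = carlitz a + carlitz b.
Proof.
pose n := maxn (size a) (size b).
rewrite !(@carlitz_widen n) ?leq_maxl ?leq_maxr ?size_polyD //.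
by rewrite -big_split; apply: eq_bigr => i _; rewrite coefD polyCD scalerDl.
Qed.

Lemma carlitzZ (c : F) a : carlitz (c *: a) = c%:P *: carlitz a.
Proof.
rewrite (@carlitz_widen (size a)) ?size_scale_leq // scaler_sumr.
by apply: eq_bigr => i _; rewrite coefZ polyCM scalerA.
Qed.

Lemma carlitz1 : carlitz 1 = 'X.
Proof. by rewrite /carlitz size_poly1 big_ord1 coefC eqxx scale1r. Qed.

Lemma carlitzX : carlitz 'X = carlitz_theta.
Proof.
rewrite /carlitz size_polyX big_ord_recr big_ord1 /= !coefX /=.
by rewrite scale0r scale1r add0r comp_polyXr.
Qed.

Lemma carlitz_theta_comp0 : carlitz_theta \Po 0 = 0.
Proof.
rewrite /carlitz_theta comp_polyD comp_polyZ comp_polyX comp_Xn_poly.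
by rewrite scaler0 expr0n -[(_ == _)%N]negbK -lt0n (cardD1 0) add0r.
Qed.

Lemma carlitz_theta_compD (P Q : {poly {poly F}}) :
  carlitz_theta \Po (P + Q) = (carlitz_theta \Po P) + (carlitz_theta \Po Q).
Proof.
rewrite /carlitz_theta !comp_polyD !comp_polyZ !comp_polyX !comp_Xn_poly.
have [p pr_p pF] := finPcharP F.
have pchP : [pchar {poly {poly F}}]%R =i (p : nat_pred).
  by move=> q; rewrite !pchar_poly (pcharf_eq pF).
rewrite exprDn_pchar; first by rewrite scalerDr addrACA.
rewrite (eq_pnat _ pchP) -cardsT.
exact: (abelem_pgroup (fin_ring_pchar_abelem pF)).
Qed.

Lemma carlitz_theta_compZ (c : F) (P : {poly {poly F}}) :
  carlitz_theta \Po (c%:P *: P) = c%:P *: (carlitz_theta \Po P).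
Proof.
rewrite /carlitz_theta !comp_polyD !comp_polyZ !comp_polyX !comp_Xn_poly.
by rewrite exprZn -polyC_exp expf_card scalerDr !scalerA mulrC.
Qed.

Lemma carlitzXM a : carlitz ('X * a) = carlitz_theta \Po carlitz a.
Proof.
have compS n (P : nat -> {poly {poly F}}) :
    carlitz_theta \Po (\sum_(i < n) P i) = \sum_(i < n) (carlitz_theta \Po P i).
  elim: n => [|n IHn]; first by rewrite !big_ord0 carlitz_theta_comp0.
  by rewrite !big_ord_recr /= carlitz_theta_compD IHn.
rewrite (@carlitz_widen (size a).+1); last first.
  by rewrite mulrC (leq_trans (size_polyMleq _ _)) // size_polyX addn2.
rewrite big_ord_recl coefXM /= scale0r add0r.
rewrite [in RHS]/carlitz.
rewrite (compS _ (fun i => (a`_i)%:P *: iter i (fun P => carlitz_theta \Po P) 'X)).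
by apply: eq_bigr => i _; rewrite coefXM /= carlitz_theta_compZ.
Qed.

Lemma carlitzM a b : carlitz (a * b) = carlitz a \Po carlitz b.
Proof.
elim/poly_ind: a => [|a c IHa].
  by rewrite mul0r /carlitz size_poly0 big_ord0 comp_poly0.
have carlitzC (d : F) : carlitz d%:P = d%:P *: 'X.
  by rewrite -[in LHS]alg_polyC carlitzZ carlitz1.
have -> : (a * 'X + c%:P) * b = 'X * (a * b) + c *: b.
  by rewrite mulrDl mul_polyC mulrAC mulrC.
rewrite !carlitzD carlitzXM carlitzZ IHa carlitzC [a * 'X]mulrC carlitzXM.
by rewrite comp_polyD comp_polyZ comp_polyX comp_polyA.
Qed.

End CarlitzModule.

Section Infinity.
Variables (F : finFieldType) (R : realType) (C : fieldType).
Variables (iota : {rmorphism {poly F} -> C}) (v : C -> R).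
Implicit Types (a : {poly F}) (x y z u l : C) (s : seq int).

Definition vcvg {T : Type} (f : T -> C) (G : set_system T) l :=
  (v (f t - l) @[t --> G]) --> (0 : R).

(* The limit of a v-convergent sequence, and 0 otherwise. *)
Definition vlim (f : nat -> C) : C := xget 0 [set l | vcvg f \oo l].

(* K_oo = F((1/theta)) inside C: values of the Laurent series
   theta^N \sum_i c_i theta^-i. *)
Definition Kinfty : set C := [set x | exists (N : nat) (c : nat -> F),
  vcvg (fun n : nat =>
    iota 'X ^+ N * \sum_(i < n) iota (c i)%:P * iota 'X ^- i) \oo x].

(* The algebraic closure of K_oo in C. *)
Definition Kinfty_alg : set C := [set y | exists P : {poly C},
  [/\ P != 0, forall i, Kinfty P`_i & root P y]].

(* C, with absolute value v and A embedded by iota, is the completion C_oo of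
   an algebraic closure of K_oo, and |theta| = r. This determines (C, iota, v)
   up to isometric isomorphism. *)
Record is_Cinfty : Prop := IsCinfty {
  Cinfty_ge0 : forall x, 0 <= v x;
  Cinfty_eq0 : forall x, v x = 0 <-> x = 0;
  Cinfty_mul : forall x y, v (x * y) = v x * v y;
  Cinfty_ultra : forall x y, v (x + y) <= Num.max (v x) (v y);
  Cinfty_theta : v (iota 'X) = #|F|%:R;
  Cinfty_closed : forall P : {poly C}, (1 < size P)%N ->
    (forall i, Kinfty_alg P`_i) -> exists2 y, Kinfty_alg y & root P y;
  Cinfty_dense : forall x (e : R), 0 < e ->
    exists2 y, Kinfty_alg y & v (x - y) < e;
  Cinfty_complete : forall f : nat -> C,
    (forall e : R, 0 < e -> exists N, forall m n : nat,
       (N <= m)%N -> (N <= n)%N -> v (f m - f n) < e) ->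
    exists l, vcvg f \oo l
}.

Definition carlitz_D (i : nat) : {poly F} :=
  \prod_(j < i) ('X^(#|F| ^ i) - 'X^(#|F| ^ j)).

Definition carlitz_exp z : C :=
  vlim (fun n => \sum_(i < n) z ^+ (#|F| ^ i) / iota (carlitz_D i)).

(* A period is a generator of the lattice ker exp_C; it is unique up to a
   factor in F^*. *)
Definition is_carlitz_period (pi_ : C) :=
  forall z, carlitz_exp z = 0 <-> exists a, z = pi_ * iota a.

Definition carlitz_eval a u : C := (map_poly iota (carlitz a)).[u].

Definition bracket a u : C := if u == 0 then iota a else carlitz_eval a u / u.

(* Sum over A_{+,d}, viewed in the finite type of polynomials of size <= d+1. *)
Definition monic_sum (d : nat) (f : {poly F} -> C) : C :=
  \sum_(a : {poly_d.+1 F} | (val a \is monic) && (size (val a) == d.+1))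
    f (val a).

Definition power_sum (d : nat) (k : int) : C :=
  monic_sum d (fun a => iota a ^ (- k)).

Definition bracket_sum u (d : nat) (k : int) : C :=
  monic_sum d (fun a => bracket a u ^ (- k)).

(* Sum over d > d_1 > ... > d_m >= 0 of the product of the f d_j s_j. *)
Definition multi_sum (f : nat -> int -> C) (d : nat) s : C :=
  \sum_(t : (size s).-tuple 'I_d | sorted gtn [seq val i | i <- t])
    \prod_(j < size s) f (tnth t j) s`_j.

Definition S_lt (d : nat) s : C := multi_sum power_sum d s.

Definition H_lt (d : nat) s u : C := multi_sum (bracket_sum u) d s.

Definition zetaA s : C := vlim (fun d => S_lt d s).

End Infinity.

Definition deg (F : finFieldType) (a : {poly F}) : nat := (size a).-1.

(* The filter "n monic, deg n --> oo". *)
Definition monic_deg_infty (F : finFieldType) : set_system {poly F} :=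
  filter_from [set: nat] (fun N => [set n | n \is monic /\ (N <= deg n)%N]).

Lemma monic_deg_infty_proper (F : finFieldType) :
  ProperFilter (@monic_deg_infty F).
Proof.
apply: filter_from_proper => [|N _]; last first.
  by exists 'X^N; rewrite /= monicXn /deg size_polyXn.
apply: filter_from_filter => [|N M _ _]; first by exists 0%N.
exists (maxn N M) => // n [mn]; rewrite geq_max => /andP[hN hM].
by split; split.
Qed.

(* Main.v *)
(* If pi_ = 0, every lambda_n vanishes and the bracket sums are the power sums.
   Otherwise, write q = |F| and [a] for the bracket of a at lambda_n. On the ball
   v z ^ (q - 1) <= q the Carlitz exponential is a perturbation of the identity
   by a factor 1/q, hence an isometry onto the ball. It thus reaches a root
   y of y^(q-1) = - theta, and theta times a preimage of y is a zero of exp, so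
   that v pi_ ^ (q - 1) <= q ^ q. Therefore pi_ a / n lies in the ball when
   deg a < deg n, and v [a] = v (exp (pi_ a / n) / exp (pi_ / n)) = v a.
   For positive exponents this bounds the sum of the [a]^(-k) over A_{+,d} by
   q ^ (-d); for nonpositive ones the sum vanishes when d > - k, since a |-> [a]
   is F-linear. So the depth-one sums are at most M_k q ^ (-d), uniformly in n,
   which makes the tails of the nested sums uniformly small, while each nested
   sum of bounded range tends to its value at u = 0 as lambda_n tends to 0. *)

Require Import Defs.
From mathcomp Require Import all_boot all_order all_algebra.
From mathcomp Require Import all_solvable finfield qpoly ring zify.
From mathcomp Require Import all_classical all_reals all_analysis.
Set Implicit Arguments.
Unset Strict Implicit.
Unset Printing Implicit Defensive.
Import Order.TTheory GRing.Theory Num.Theory.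
Import numFieldNormedType.Exports.
Local Open Scope classical_set_scope.
Local Open Scope ring_scope.

(** * Nested sums and the algebra of brackets *)

Section MultiSum.
Variable C : fieldType.
Implicit Types (f : nat -> int -> C) (s : seq int).

(** Fixing the largest index d_1 = i leaves a sum of smaller depth bounded by i, so later estimates
    go by induction on [s]. *)
Fixpoint nested_sum f (d : nat) s : C :=
  if s is k :: s' then \sum_(i < d) f i k * nested_sum f i s' else 1.

Lemma multi_sumE f d s : multi_sum f d s = nested_sum f d s.
Proof.
(* With the index type ['I_d] fixed, the sum over [D > d_1 > ... > d_m]
   satisfies the recursion for all [D <= d]. *)
pose G D s := \sum_(t : (size s).-tuple 'I_d | path gtn D [seq val i | i <- t])
  \prod_(j < size s) f (tnth t j) s`_j.
have Gcons D k s' : (D <= d)%N -> G D (k :: s') = \sum_(i < D) f i k * G i s'.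
  move=> leDd; rewrite (big_ord_widen _ (fun i => f i k * G i s') leDd).
  rewrite /G /= (reindex (fun p : 'I_d * (size s').-tuple 'I_d =>
    [tuple of p.1 :: p.2])) /=; last first.
    exists (fun t : (size s').+1.-tuple 'I_d => (thead t, [tuple of behead t])).
      by move=> [i t] _ /=; congr pair; apply: val_inj.
    by move=> t _; rewrite [RHS]tuple_eta.
  transitivity (\sum_(p : 'I_d * (size s').-tuple 'I_d |
      (p.1 < D)%N && path gtn p.1 [seq val i | i <- p.2])
      f p.1 k * \prod_(j < size s') f (tnth p.2 j) s'`_j).
    apply: eq_bigr => -[i t] _ /=; rewrite big_ord_recl /=; congr (_ * _).
    by apply: eq_bigr => j _; rewrite tnthS.
  rewrite -(pair_big_dep (fun i : 'I_d => (i < D)%N)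
    (fun i (t : (size s').-tuple 'I_d) => path gtn i [seq val j | j <- t])
    (fun i t => f i k * \prod_(j < size s') f (tnth t j) s'`_j)) /=.
  by apply: eq_bigr => i _; rewrite big_distrr.
have GE s' D : (D <= d)%N -> G D s' = nested_sum f D s'.
  elim: s' D => [|k s' IHs] D leDd.
    rewrite /G /= (big_pred1 [tuple]) ?big_ord0 // => t.
    have -> : t = [tuple] by apply: tuple0.
    by rewrite /= eqxx.
  rewrite Gcons //=; apply: eq_bigr => i _; congr (_ * _).
  by apply: IHs; rewrite ltnW // (leq_trans (ltn_ord i)).
(* All entries of [t] are below [d], so being sorted is the same as being a path from [d]. *)
rewrite -GE //; apply: eq_bigl => t.
by case: t => -[|i t] //= _; rewrite ltn_ord.
Qed.

End MultiSum.

(** * F-linearity of the brackets and sums over spaces of polynomials *)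

Section Algebra.
Variables (F : finFieldType) (C : fieldType) (iota : {rmorphism {poly F} -> C}).
Implicit Types (a b : {poly F}) (u x y : C).
Local Notation q := #|F|.

Lemma pnat_card p : p \in [pchar F] -> p.-nat q.
Proof.
move=> pF; rewrite -cardsT; exact: (abelem_pgroup (fin_ring_pchar_abelem pF)).
Qed.

Lemma natr_card : q%:R = 0 :> C.
Proof.
have [p pr_p pF] := finPcharP F.
have -> : q%:R = iota (q%:R : F)%:P by rewrite polyC_natr rmorph_nat.
suff -> : q%:R = 0 :> F by rewrite rmorph0.
have [[|k] qE] := p_natP (pnat_card pF).
  by have := finNzRing_gt1 F; rewrite qE.
by apply/eqP; rewrite -(dvdn_pcharf pF) qE dvdn_exp.
Qed.

Lemma exprD_card i x y :
  (x + y) ^+ (q ^ i) = x ^+ (q ^ i) + y ^+ (q ^ i).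
Proof.
have [p pr_p pF] := finPcharP F.
have pC : p \in [pchar C].
  by apply: (rmorph_pchar iota); apply: (rmorph_pchar (@polyC F)).
rewrite exprDn_pchar // pnatX (eq_pnat _ (pcharf_eq pC)).
by rewrite pnat_card.
Qed.

Lemma expr_card_const (c : F) i : iota c%:P ^+ (q ^ i) = iota c%:P.
Proof.
elim: i => [|i IHi]; first by rewrite expn0 expr1.
by rewrite expnS exprM -rmorphXn -polyC_exp expf_card.
Qed.

Lemma carlitz_evalD a b u :
  carlitz_eval iota (a + b) u = carlitz_eval iota a u + carlitz_eval iota b u.
Proof. by rewrite /carlitz_eval carlitzD rmorphD hornerD. Qed.

Lemma carlitz_evalZ c a u :
  carlitz_eval iota (c *: a) u = iota c%:P * carlitz_eval iota a u.
Proof. by rewrite /carlitz_eval carlitzZ map_polyZ hornerZ. Qed.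

Lemma carlitz_eval1 u : carlitz_eval iota 1 u = u.
Proof. by rewrite /carlitz_eval carlitz1 map_polyX hornerX. Qed.

Lemma carlitz_evalXM a u : carlitz_eval iota ('X * a) u =
  iota 'X * carlitz_eval iota a u + carlitz_eval iota a u ^+ q.
Proof.
rewrite /carlitz_eval carlitzXM map_comp_poly horner_comp /carlitz_theta.
by rewrite rmorphD /= map_polyZ /= map_polyX map_polyXn hornerD hornerZ hornerX
  hornerXn.
Qed.

Lemma bracketD a b u : bracket iota (a + b) u = bracket iota a u + bracket iota b u.
Proof.
by rewrite /bracket; case: eqP => _; rewrite ?rmorphD // carlitz_evalD mulrDl.
Qed.

Lemma bracketZ c a u : bracket iota (c *: a) u = iota c%:P * bracket iota a u.
Proof.
rewrite /bracket; case: eqP => _; first by rewrite -mul_polyC rmorphM.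
by rewrite carlitz_evalZ mulrA.
Qed.

Lemma bracket0 a : bracket iota a 0 = iota a.
Proof. by rewrite /bracket eqxx. Qed.

Lemma bracket1 u : bracket iota 1 u = 1.
Proof.
by rewrite /bracket; case: eqP => [_|/eqP u0]; rewrite ?rmorph1 // carlitz_eval1 divff.
Qed.

(** This is C_theta(X) = theta X + X^q divided by u; at u = 0 the last term vanishes because q - 1 >
    0. *)
Lemma bracketXM a u : bracket iota ('X * a) u =
  iota 'X * bracket iota a u + u ^+ q.-1 * bracket iota a u ^+ q.
Proof.
have q1 := finNzRing_gt1 F.
rewrite /bracket; case: eqP => [->|/eqP u0].
  by rewrite expr0n -subn1 subn_eq0 leqNgt q1 mul0r addr0 rmorphM.
rewrite carlitz_evalXM mulrDl mulrA; congr (_ + _).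
rewrite expr_div_n -[X in u ^- X](prednK (ltnW q1)) exprS invfM.
by rewrite mulrCA; congr (_ * _); rewrite mulrCA divff ?mulr1 // expf_neq0.
Qed.

(** Splitting off the coefficient [c] of X^d permits induction on the dimension. *)
Lemma sum_polynS d (f : {poly F} -> C) : \sum_(a : {poly_d.+1 F}) f (val a) =
  \sum_(c : F) \sum_(a : {poly_d F}) f (val a + c *: 'X^d).
Proof.
rewrite pair_bigA /=.
have sz (p : F * {poly_d F}) : (size (val p.2 + p.1 *: 'X^d)%R <= d.+1)%N.
  rewrite (leq_trans (size_polyD _ _)) // geq_max.
  rewrite (leq_trans (size_npoly _)) //=.
  by rewrite (leq_trans (size_scale_leq _ _)) // size_polyXn.
rewrite (reindex (fun p : F * {poly_d F} =>
  npolyp d.+1 (val p.2 + p.1 *: 'X^d))) /=; last first.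
  exists (fun a : {poly_d.+1 F} => ((val a)`_d, npolyp d (val a))).
    move=> [c a] _ /=; rewrite (npolypK (sz (c, a))) /=.
    have ad : (val a)`_d = 0 by rewrite nth_default // size_npoly.
    congr pair; first by rewrite coefD coefZ coefXn eqxx mulr1 ad add0r.
    apply/val_inj/polyP => i; rewrite coef_npolyp coefD coefZ coefXn.
    case: ltnP => [lt_id|le_di]; first by rewrite ltn_eqF // mulr0 addr0.
    by rewrite nth_default // (leq_trans (size_npoly a)).
  move=> a _; apply/val_inj/polyP => i /=.
  rewrite coef_npolyp coefD coef_npolyp coefZ coefXn ltnS.
  case: (ltngtP i d) => [_|hi|->]; rewrite ?mulr0 ?addr0 //.
    by rewrite nth_default // (leq_trans (size_npoly a)).
  by rewrite add0r mulr1.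
by apply: eq_bigr => p _; rewrite (npolypK (sz p)).
Qed.

(** Monic polynomials of degree d form the affine space X^d + A_{<d}, a shape to which F-linearity
    applies. *)
Lemma monic_sumE d (f : {poly F} -> C) :
  monic_sum d f = \sum_(a : {poly_d F}) f ('X^d + val a).
Proof.
rewrite /monic_sum big_mkcond /=.
rewrite (sum_polynS d (fun a => if (a \is monic) && (size a == d.+1) then f a else 0)).
have sz (a : {poly_d F}) c : c != 0 -> (size (val a) < size (c *: 'X^d : {poly F}))%N.
  by move=> c0; rewrite size_scale // size_polyXn ltnS size_npoly.
rewrite (bigD1 1) //= [X in _ + X]big1 ?addr0 => [|c c1]; last first.
  apply: big1 => a _; case: andP => // -[]; rewrite monicE => /eqP mon /eqP sza.
  have [c0|c0] := eqVneq c 0.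
    by move: sza (size_npoly a); rewrite c0 scale0r addr0 => ->; rewrite ltnn.
  move: mon; rewrite lead_coefDr ?sz // lead_coefZ lead_coefXn mulr1 => ce.
  by rewrite ce eqxx in c1.
apply: eq_bigr => a _; rewrite scale1r addrC.
have := sz a 1 (oner_neq0 _); rewrite scale1r => szX.
by rewrite monicE size_polyDl // lead_coefDl // lead_coefXn size_polyXn !eqxx.
Qed.

(** Stated for any F-linear [phi] so as to cover the brackets at every u; the shift [x] will be the
    bracket of X^d. *)
Lemma sum_expr_vanish (phi : {poly F} -> C) :
  (forall a b, phi (a + b) = phi a + phi b) ->
  (forall c a, phi (c *: a) = iota c%:P * phi a) ->
  forall d k x, (k < d)%N -> \sum_(a : {poly_d F}) (x + phi (val a)) ^+ k = 0.
Proof.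
move=> phiD phiZ; elim=> [|d IHd] k x //; rewrite ltnS => le_kd.
rewrite (sum_polynS d (fun a => (x + phi a) ^+ k)).
(* Expanding in the top coefficient [c] leaves only the term free of [c], by
   induction, and that one is multiplied by [q = 0]. *)
transitivity (\sum_(c : F) \sum_(a : {poly_d F}) (x + phi (val a)) ^+ k);
  last by rewrite sumr_const -mulr_natr natr_card mulr0.
apply: eq_bigr => c _.
under eq_bigr do rewrite phiD phiZ addrA exprDn.
rewrite exchange_big /= big_ord_recl /= [X in _ + X]big1 ?addr0 => [|j _].
  by apply: eq_bigr => a _; rewrite subn0 expr0 mulr1 bin0.
rewrite sumrMnl -big_distrl /= IHd ?mul0r ?mul0rn //.
by rewrite /bump /= (leq_trans _ le_kd) // ltn_subrL (leq_trans _ (ltn_ord j)).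
Qed.

Lemma monic_sum_bracket_vanish d k u :
  (k < d)%N -> monic_sum d (fun a => bracket iota a u ^+ k) = 0.
Proof.
move=> kd; rewrite monic_sumE.
under eq_bigr do rewrite bracketD.
apply: (@sum_expr_vanish (bracket iota ^~ u)) => // [a b|c a].
  exact: bracketD.
exact: bracketZ.
Qed.

(** The factor j = 0 is split off; by Frobenius the others are the q-th powers of the factors of
    D_i. *)
Lemma carlitz_DS i :
  carlitz_D F i.+1 = ('X^(q ^ i.+1) - 'X) * carlitz_D F i ^+ q.
Proof.
rewrite /carlitz_D big_ord_recl expn0 expr1 -prodrXl; congr (_ * _).
apply: eq_bigr => j _.
have [p pr_p pF] := finPcharP F.
have pP : p \in [pchar {poly F}] by apply: (rmorph_pchar (@polyC F)).
have pq : [pchar {poly F}].-nat q by rewrite (eq_pnat _ (pcharf_eq pP)) pnat_card.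
rewrite !expnSr !exprM; apply/eqP.
by rewrite subr_eq -exprDn_pchar // subrK.
Qed.

End Algebra.

(** * Ultrametric convergence *)

Section AbsoluteValue.
Variables (F : finFieldType) (R : realType) (C : fieldType).
Variables (iota : {rmorphism {poly F} -> C}) (v : C -> R).
Hypothesis hC : is_Cinfty iota v.
Implicit Types (a b : {poly F}) (x y z : C) (e : R).
Local Notation q := #|F|.

Let v_ge0 x : 0 <= v x := Cinfty_ge0 hC x.
Let vM x y : v (x * y) = v x * v y := Cinfty_mul hC x y.

Lemma abs0 : v 0 = 0. Proof. by apply/(Cinfty_eq0 hC). Qed.

Lemma abs_eq0 x : (v x == 0) = (x == 0).
Proof. by apply/eqP/eqP => /(Cinfty_eq0 hC). Qed.

Lemma abs_gt0 x : (0 < v x) = (x != 0).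
Proof. by rewrite lt_def abs_eq0 v_ge0 andbT. Qed.

Lemma abs1 : v 1 = 1.
Proof.
have v1 : v 1 != 0 by rewrite abs_eq0 oner_neq0.
by apply: (mulIf v1); rewrite -vM !mul1r.
Qed.

Lemma absX x n : v (x ^+ n) = v x ^+ n.
Proof. by elim: n => [|n IHn]; rewrite ?expr0 ?abs1 // !exprS vM IHn. Qed.

Lemma absN x : v (- x) = v x.
Proof.
suff v1 : v (-1) = 1 by rewrite -mulN1r vM v1 mul1r.
by apply/eqP; rewrite -(@pexpr_eq1 _ _ 2) // -absX sqrrN expr1n abs1.
Qed.

Lemma absV x : v x^-1 = (v x)^-1.
Proof.
have [->|x0] := eqVneq x 0; first by rewrite invr0 abs0 invr0.
have vx : v x != 0 by rewrite abs_eq0.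
by apply: (mulIf vx); rewrite -vM !mulVf // abs1.
Qed.

Lemma absB x y : v (x - y) = v (y - x).
Proof. by rewrite -absN opprB. Qed.

Lemma absD_le x y e : v x <= e -> v y <= e -> v (x + y) <= e.
Proof.
by move=> xe ye; rewrite (le_trans (Cinfty_ultra hC _ _)) // ge_max xe.
Qed.

Lemma absD_lt x y e : v x < e -> v y < e -> v (x + y) < e.
Proof.
by move=> xe ye; rewrite (le_lt_trans (Cinfty_ultra hC _ _)) // gt_max xe.
Qed.

Lemma abs_sum_le (I : Type) (r : seq I) (P : pred I) (f : I -> C) e :
  0 <= e -> (forall i, P i -> v (f i) <= e) -> v (\sum_(i <- r | P i) f i) <= e.
Proof.
move=> e0 fe; elim/big_ind: _ => // [|x y]; first by rewrite abs0.
exact: absD_le.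
Qed.

Lemma absD_eq x y : v x < v y -> v (x + y) = v y.
Proof.
move=> xy; apply/eqP; rewrite eq_le absD_le ?(ltW xy) //= leNgt.
apply/negP => h; suff : v y < v y by rewrite ltxx.
by rewrite -{1}[y](addKr x) addrC absD_lt ?absN // addrC.
Qed.

(** From c^q = c, the nonnegative real v(c) satisfies v(c)^(q-1) = 1. *)
Lemma abs_const (c : F) : c != 0 -> v (iota c%:P) = 1.
Proof.
move=> c0; apply/eqP; have q1 := finNzRing_gt1 F.
have vc : v (iota c%:P) != 0.
  rewrite abs_eq0; apply/eqP => ic0; have := oner_neq0 C.
  by rewrite -(rmorph1 iota) -polyC1 -(divff c0) polyCM rmorphM ic0 mul0r eqxx.
rewrite -(@pexpr_eq1 _ _ q.-1) ?v_ge0 -?subn1 ?subn_gt0 //.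
apply/eqP/(mulfI vc); rewrite -exprS subn1 prednK ?(ltnW q1) //.
by rewrite -absX -[q]expn1 expr_card_const mulr1.
Qed.

(** Horner induction: a nonzero multiple of X outweighs a constant, of absolute value at most 1. *)
Lemma abs_iota a : a != 0 -> v (iota a) = q%:R ^+ (deg a).
Proof.
have q1 : (1 : R) < q%:R by rewrite ltr1n finNzRing_gt1.
elim/poly_ind: a => [|a c IHa]; first by rewrite eqxx.
rewrite /deg size_MXaddC; have [->|a0] := eqVneq a 0.
  rewrite mul0r add0r polyC_eq0 => c0.
  by rewrite (negPf c0) /= size_poly0 abs_const.
move=> _ /=; have aE : v (iota (a * 'X)) = q%:R ^+ (size a).
  rewrite rmorphM vM IHa // (Cinfty_theta hC) -exprSr prednK //.
  by rewrite size_poly_gt0.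
rewrite addrC rmorphD absD_eq ?aE //.
apply: (@le_lt_trans _ _ 1); last by rewrite exprn_egt1 ?size_poly_eq0.
have [->|c0] := eqVneq c 0; first by rewrite rmorph0 abs0 ler01.
by rewrite abs_const.
Qed.

Lemma iota_eq0 a : (iota a == 0) = (a == 0).
Proof.
apply/idP/idP => [|/eqP->]; last by rewrite rmorph0.
apply: contraLR => a0; rewrite -abs_eq0 abs_iota // expf_eq0 pnatr_eq0.
by rewrite gtn_eqF ?andbF // ltnW // finNzRing_gt1.
Qed.

(** The ultrametric inequality replaces the sum of the increments by their largest bound, the one at
    i = N, so no geometric-series factor appears. *)
Lemma abs_telescope (f : nat -> C) (K : R) N m : 0 <= K ->
  (forall i, (N <= i < m)%N -> v (f i.+1 - f i) <= K * q%:R ^- i) ->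
  (N <= m)%N -> v (f m - f N) <= K * q%:R ^- N.
Proof.
move=> K0; have qR : 0 < q%:R :> R by rewrite ltr0n ltnW // finNzRing_gt1.
elim: m => [|m IHm] fK; rewrite leq_eqVlt => /predU1P[->|].
- by rewrite subrr abs0 divr_ge0 ?exprn_ge0 ?ler0n.
- by rewrite ltn0.
- by rewrite subrr abs0 divr_ge0 ?exprn_ge0 ?ler0n.
rewrite ltnS => Nm; rewrite -(subrK (f m) (f m.+1)) -addrA absD_le //.
  rewrite (le_trans (fK _ _)) ?Nm ?ltnSn // ler_wpM2l //.
  by rewrite lef_pV2 ?posrE ?exprn_gt0 // ler_eXn2l // ltr1n finNzRing_gt1.
by apply: IHm => // i /andP[Ni im]; rewrite fK // Ni ltnS ltnW.
Qed.

(** * Limits along a filter for the absolute value *)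

Section Filters.
Context {T : Type} {G : set_system T} {FG : Filter G}.
Implicit Types (f g : T -> C) (l m : C).

Lemma vcvgP f l : vcvg v f G l <->
  forall e, 0 < e -> \forall t \near G, v (f t - l) < e.
Proof.
split=> [/cvgr0Pnorm_lt fl e /fl|fl]; last first.
  apply/cvgr0Pnorm_lt => e /fl; apply: filterS => t.
  by rewrite ger0_norm ?v_ge0.
by apply: filterS => t; rewrite ger0_norm ?v_ge0.
Qed.

Lemma vcvg_cst l : vcvg v (fun=> l) G l.
Proof. by apply/vcvgP => e e0; apply: nearW => t; rewrite subrr abs0. Qed.

Lemma vcvgD f g l m : vcvg v f G l -> vcvg v g G m ->
  vcvg v (fun t => f t + g t) G (l + m).
Proof.
move=> /vcvgP fl /vcvgP gm; apply/vcvgP => e e0.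
apply: filterS (filterI (fl e e0) (gm e e0)) => t [h1 h2].
by rewrite opprD addrACA absD_lt.
Qed.

Lemma vcvgM f g l m : vcvg v f G l -> vcvg v g G m ->
  vcvg v (fun t => f t * g t) G (l * m).
Proof.
move=> /vcvgP fl /vcvgP gm; apply/vcvgP => e e0.
(* [K] dominates the three factors 1, v l and v m that multiply small differences below. *)
pose K := 1 + v l + v m; have K0 : 0 < K.
  by rewrite /K -addrA ltr_pwDl // addr_ge0.
have eK : 0 < e / K by rewrite divr_gt0.
apply: filterS (filterI (fl _ eK) (filterI (gm _ eK) (gm 1 ltr01))) => t [h1 [h2 h3]].
have -> : f t * g t - l * m = (f t - l) * (g t - m) + (l * (g t - m) + (f t - l) * m).
  by ring.
have small c x : c <= K -> v x < e / K -> c * v x < e.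
  move=> cK xe; apply: (@le_lt_trans _ _ (K * v x)); first exact: ler_wpM2r.
  by rewrite mulrC -ltr_pdivlMr.
rewrite !absD_lt // vM.
- by rewrite mulrC small // ltW // (lt_le_trans h3) // /K -addrA lerDl addr_ge0.
- by rewrite small // /K addrAC lerDr addr_ge0.
- by rewrite mulrC small // /K lerDr addr_ge0.
Qed.

Lemma vcvgX f l n : vcvg v f G l -> vcvg v (fun t => f t ^+ n) G (l ^+ n).
Proof.
move=> fl; elim: n => [|n IHn]; first exact: vcvg_cst.
have := vcvgM fl IHn; under eq_fun do rewrite -exprS; by rewrite -exprS.
Qed.

Lemma vcvgV f l : l != 0 -> vcvg v f G l -> vcvg v (fun t => (f t)^-1) G l^-1.
Proof.
move=> l0 /vcvgP fl; apply/vcvgP => e e0; have vl : 0 < v l by rewrite abs_gt0.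
(* Once v(f - l) < v(l), also v(f) = v(l), and the inverses differ by v(f - l) / v(l)^2. *)
have e'0 : 0 < e * (v l * v l) by rewrite !mulr_gt0.
apply: filterS (filterI (fl _ e'0) (fl _ vl)) => t [h1 h2].
have fE : v (f t) = v l by rewrite -(subrK l (f t)) absD_eq.
have f0 : f t != 0 by rewrite -abs_gt0 fE.
have -> : (f t)^-1 - l^-1 = - (f t - l) / (f t * l) by field; rewrite l0 f0.
by rewrite vM absN absV vM fE ltr_pdivrMr // mulr_gt0.
Qed.

Lemma vcvg_expz f l (k : int) :
  l != 0 -> vcvg v f G l -> vcvg v (fun t => f t ^ k) G (l ^ k).
Proof.
by case: k => n l0 fl; [exact: vcvgX | apply/vcvgV/vcvgX; rewrite // expf_neq0].
Qed.

Lemma vcvg_sum (I : Type) (r : seq I) (P : pred I) (f : I -> T -> C) (l : I -> C) :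
  (forall i, P i -> vcvg v (f i) G (l i)) ->
  vcvg v (fun t => \sum_(i <- r | P i) f i t) G (\sum_(i <- r | P i) l i).
Proof.
move=> fl; elim: r => [|i r IHr].
  by rewrite big_nil; under eq_fun do rewrite big_nil; exact: vcvg_cst.
rewrite big_cons; under eq_fun do rewrite big_cons.
by case: ifP => // Pi; apply: vcvgD => //; apply: fl.
Qed.

End Filters.

Lemma vcvg_unique {T : Type} (G : set_system T) {FG : ProperFilter G}
  (f : T -> C) l m : vcvg v f G l -> vcvg v f G m -> l = m.
Proof.
move=> /vcvgP fl /vcvgP fm; apply/eqP; rewrite -subr_eq0 -abs_eq0.
apply/negPn/negP => lm0; have lm : 0 < v (l - m) by rewrite lt_def lm0 v_ge0.
have [t [h1 h2]] := filter_ex (filterI (fl _ lm) (fm _ lm)).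
suff : v (l - m) < v (l - m) by rewrite ltxx.
have {1}-> : l - m = (l - f t) + (f t - m) by rewrite addrA subrK.
by rewrite absD_lt // absB.
Qed.

(** If v(l - x) > e, a value f t in the ball and closer to l than v(l - x) would give v(l - x) < v(l
    - x). *)
Lemma vcvg_abs_le {T : Type} (G : set_system T) {FG : ProperFilter G}
  (f : T -> C) l x e : vcvg v f G l -> (\forall t \near G, v (f t - x) <= e) ->
  v (l - x) <= e.
Proof.
move=> /vcvgP fl fe; rewrite leNgt; apply/negP => elx.
have lx : 0 < v (l - x).
  have [t te] := filter_ex fe; exact: le_lt_trans (le_trans (v_ge0 _) te) elx.
have [t [h1 h2]] := filter_ex (filterI (fl _ lx) fe).
suff : v (l - x) < v (l - x) by rewrite ltxx.
have {1}-> : l - x = (l - f t) + (f t - x) by rewrite addrA subrK.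
by rewrite absD_lt ?(le_lt_trans h2) // absB.
Qed.

Lemma vlimE (f : nat -> C) l : vcvg v f \oo l -> vlim v f = l.
Proof.
move=> fl; apply: (vcvg_unique _ fl).
by rewrite /vlim; apply: (xgetPex 0); exists l.
Qed.

Lemma geometric_lt (x e : R) : 0 < e -> exists N : nat, x * q%:R ^- N < e.
Proof.
move=> e0; have q1 : `|(q%:R : R)^-1| < 1.
  have qR : 1 < (q%:R : R) by rewrite ltr1n finNzRing_gt1.
  by rewrite ger0_norm ?invr_ge0 ?ler0n // invf_lt1 // (lt_trans ltr01).
have /cvgrPdist_lt/(_ e e0) [N _ /(_ N (leqnn N))] :
    (fun n => x * q%:R ^- n) @ \oo --> (0 : R).
  under eq_fun do rewrite -exprVn; exact: cvg_geometric.
by rewrite /= sub0r normrN => h; exists N; apply: le_lt_trans h; exact: ler_norm.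
Qed.

(* In an ultrametric space it suffices to bound the distance to the [N]-th term. *)
Lemma vcvg_geometric (f : nat -> C) (K : R) :
  (forall N n, (N <= n)%N -> v (f n - f N) <= K * q%:R ^- N) ->
  exists2 l, vcvg v f \oo l & forall N, v (l - f N) <= K * q%:R ^- N.
Proof.
move=> fK; have [e e0|l fl] := @Cinfty_complete _ _ _ _ _ hC f.
  have [N KN] := geometric_lt K e0; exists N => m n mN nN.
  have -> : f m - f n = (f m - f N) + (f N - f n) by rewrite addrA subrK.
  by apply: le_lt_trans KN; rewrite absD_le // ?[v (f N - _)]absB fK.
exists l => // N; apply: (vcvg_abs_le fl).
by exists N => // n /= Nn; exact: fK.
Qed.

End AbsoluteValue.

(** * The Carlitz exponential near 0 and its period *)

(** Serves to weigh z^(q^i) against D_i: for n = q the sum is (q^i - 1)/(q - 1), and i q^i is the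
    degree of D_i. *)
Lemma sum_expn_le (n i : nat) : (1 < n)%N -> (\sum_(j < i) n ^ j + i <= i * n ^ i)%N.
Proof.
move=> n1; elim: i => [|i IHi]; first by rewrite big_ord0.
have m0 : (0 < n ^ i)%N by rewrite expn_gt0 ltnW.
rewrite big_ord_recr /= expnS; apply: (@leq_trans (i.+1 * (2 * n ^ i))); last first.
  by rewrite leq_mul2l leq_mul2r n1 !orbT.
by move: (n ^ i)%N (\sum_(j < i) n ^ j)%N IHi m0 => m S; nia.
Qed.

Section Exponential.
Variables (F : finFieldType) (R : realType) (C : fieldType).
Variables (iota : {rmorphism {poly F} -> C}) (v : C -> R).
Hypothesis hC : is_Cinfty iota v.
Implicit Types (a b n : {poly F}) (x y z : C).
Local Notation q := #|F|.
Local Notation theta := (iota 'X).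
Local Notation expC := (carlitz_exp iota v).

Let v_ge0 x : 0 <= v x := Cinfty_ge0 hC x.
Let vM x y : v (x * y) = v x * v y := Cinfty_mul hC x y.
Let q_gt1 : (1 < q)%N := finNzRing_gt1 F.
Let qR_gt0 : 0 < q%:R :> R. Proof. by rewrite ltr0n ltnW. Qed.
Let qR_gt1 : 1 < q%:R :> R. Proof. by rewrite ltr1n. Qed.

Definition exp_term z i : C := z ^+ (q ^ i) / iota (carlitz_D F i).
Definition exp_psum z m : C := \sum_(i < m) exp_term z i.

(** The recursion for D_i gives the degree: q^(i+1) + q (i q^i) = (i + 1) q^(i+1). *)
Lemma abs_carlitz_D i : v (iota (carlitz_D F i)) = q%:R ^+ (i * q ^ i).
Proof.
elim: i => [|i IHi]; first by rewrite /carlitz_D big_ord0 rmorph1 (abs1 hC) mul0n.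
have sz : (size ('X : {poly F}) < size ('X^(q ^ i.+1) : {poly F}))%N.
  by rewrite size_polyX size_polyXn ltnS (leq_trans q_gt1) // expnS leq_pmulr //
    expn_gt0 ltnW.
have X0 : 'X^(q ^ i.+1) - 'X != 0 :> {poly F}.
  by rewrite -size_poly_eq0 size_polyDl ?size_polyN // size_polyXn.
rewrite carlitz_DS rmorphM vM rmorphXn (absX hC) IHi (abs_iota hC) // /deg.
rewrite size_polyDl ?size_polyN // size_polyXn /= -exprM -exprD.
by rewrite mulSn -mulnA -expnSr.
Qed.

Lemma iota_carlitz_D_neq0 i : iota (carlitz_D F i) != 0.
Proof. by rewrite -(abs_gt0 hC) abs_carlitz_D exprn_gt0. Qed.

Lemma exp_term0 z : exp_term z 0 = z.
Proof. by rewrite /exp_term /carlitz_D big_ord0 rmorph1 divr1 expn0 expr1. Qed.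

Lemma exp_psum1 z : exp_psum z 1 = z.
Proof. by rewrite /exp_psum big_ord1 exp_term0. Qed.

Lemma exp_psumS z m : exp_psum z m.+1 = exp_psum z m + exp_term z m.
Proof. by rewrite /exp_psum big_ord_recr. Qed.

Lemma exp_psumD x y m : exp_psum (x + y) m = exp_psum x m + exp_psum y m.
Proof.
rewrite /exp_psum -big_split; apply: eq_bigr => i _ /=.
by rewrite /exp_term (exprD_card iota) mulrDl.
Qed.

Lemma exp_psumB x y m : exp_psum (x - y) m = exp_psum x m - exp_psum y m.
Proof. by apply/eqP; rewrite eq_sym subr_eq -exp_psumD subrK. Qed.

Lemma exp_psum_const (c : F) z m : exp_psum (iota c%:P * z) m = iota c%:P * exp_psum z m.
Proof.
rewrite /exp_psum big_distrr; apply: eq_bigr => i _ /=.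
by rewrite /exp_term exprMn expr_card_const mulrA.
Qed.

(** As D_(i+1) = (theta^(q^(i+1)) - theta) D_i^q, multiplying term i+1 by the first factor gives the
    q-th power of term i. *)
Lemma exp_term_theta z i :
  exp_term (theta * z) i.+1 = theta * exp_term z i.+1 + exp_term z i ^+ q.
Proof.
have D0 := iota_carlitz_D_neq0 i; have := iota_carlitz_D_neq0 i.+1.
rewrite /exp_term carlitz_DS rmorphM rmorphXn rmorphB rmorphXn mulf_eq0 => /norP[X0 _].
rewrite exprMn expr_div_n -exprM -expnSr.
by field; rewrite X0 expf_neq0.
Qed.

(** Truncated form of exp(theta z) = C_theta(exp z); a q-th power raises the index of a term by one,
    hence the shorter sum. *)
Lemma exp_psum_theta z m :
  exp_psum (theta * z) m.+1 = theta * exp_psum z m.+1 + exp_psum z m ^+ q.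
Proof.
elim: m => [|m IHm].
  by rewrite !exp_psum1 /exp_psum big_ord0 expr0n gtn_eqF ?addr0 // ltnW.
rewrite [LHS]exp_psumS IHm exp_term_theta [in RHS]exp_psumS mulrDr.
by rewrite [in X in _ = _ + X]exp_psumS -[q in RHS]expn1 (exprD_card iota) expn1 addrACA.
Qed.

(** The equation exp(a z) = C_a(exp z), stated for limits so that convergence at z also yields
    convergence at a z, where the terms need not obey any estimate known so far. *)
Lemma vcvg_exp_psum_mul a z l : vcvg v (exp_psum z) \oo l ->
  vcvg v (exp_psum (iota a * z)) \oo (carlitz_eval iota a l).
Proof.
move=> zl; elim/poly_ind: a => [|a c IHa].
  rewrite rmorph0 mul0r -(scale0r 1) carlitz_evalZ rmorph0 mul0r.
  have -> : exp_psum 0 = fun=> 0; last exact: (vcvg_cst hC).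
  by apply/funext => m; have := exp_psum_const 0 0 m; rewrite polyC0 rmorph0 !mul0r.
rewrite [a * _]mulrC carlitz_evalD carlitz_evalXM -[c%:P]alg_polyC.
rewrite carlitz_evalZ carlitz_eval1 alg_polyC rmorphD mulrDl rmorphM -mulrA.
rewrite (_ : exp_psum _ = fun m =>
  exp_psum (theta * (iota a * z)) m + iota c%:P * exp_psum z m); last first.
  by apply/funext => m; rewrite exp_psumD exp_psum_const.
apply: (vcvgD hC); last by apply: (vcvgM hC) => //; exact: (vcvg_cst hC).
rewrite /vcvg -cvg_shiftS /=; under eq_fun do rewrite exp_psum_theta.
apply: (vcvgD hC); last exact: (vcvgX hC).
apply: (vcvgM hC); first exact: (vcvg_cst hC).
by rewrite /vcvg (cvg_shiftS (fun m => v (exp_psum (iota a * z) m - _))).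
Qed.

(** The ball of radius q^(1/(q-1)), with the root cleared. *)
Definition exp_ball : set C := [set z | v z ^+ q.-1 <= q%:R].

Lemma exp_ball_le y z : exp_ball y -> v z <= v y -> exp_ball z.
Proof.
by rewrite /exp_ball /= => by_ zy; apply: le_trans by_; rewrite lerXn2r ?nnegrE.
Qed.

Lemma abs_exp_term_le z i : exp_ball z -> v (exp_term z i) <= v z * q%:R ^- i.
Proof.
rewrite /exp_ball /= => bz.
rewrite /exp_term vM (absV hC) (absX hC) abs_carlitz_D.
have qi : (0 < q ^ i)%N by rewrite expn_gt0 ltnW.
rewrite -[X in v z ^+ X](prednK qi) exprS -mulrA ler_wpM2l //.
rewrite ler_pdivrMr ?exprn_gt0 // mulrC ler_pdivlMr ?exprn_gt0 //.
(* q^i - 1 is q - 1 times the sum of the q^j, so membership in the ball bounds v(z)^(q^i - 1) by q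
   to the power of that sum. *)
rewrite predn_exp exprM; apply: (@le_trans _ _ (q%:R ^+ (\sum_(j < i) q ^ j) * q%:R ^+ i)).
  by rewrite ler_wpM2r ?exprn_ge0 ?ler0n // lerXn2r ?nnegrE ?exprn_ge0 ?ler0n.
by rewrite -exprD ler_eXn2l // sum_expn_le.
Qed.

Lemma exp_ballP z : exp_ball z ->
  vcvg v (exp_psum z) \oo (expC z) /\ v (expC z - z) <= v z / q%:R.
Proof.
move=> bz; have [|l zl lz] := @vcvg_geometric _ _ _ _ _ hC (exp_psum z) (v z).
  move=> N m; apply: (abs_telescope hC) => // i _.
  by rewrite exp_psumS addrC addKr abs_exp_term_le.
(* The estimate is the tail bound at N = 1, where the partial sum is z itself. *)
by rewrite /carlitz_exp (vlimE hC zl); split=> //; rewrite -{1}(exp_psum1 z).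
Qed.

(** On the ball the partial sums converge, so [vlim] is a true limit and not its default 0. *)
Lemma carlitz_expB x y : exp_ball x -> exp_ball y -> expC (x - y) = expC x - expC y.
Proof.
move=> /exp_ballP[xl _] /exp_ballP[yl _]; apply: (vlimE hC).
rewrite (_ : (fun m => _) = fun m => exp_psum x m + - exp_psum y m); last first.
  by apply/funext => m; rewrite -exp_psumB.
apply: (vcvgD hC) => //; apply/(vcvgP hC) => e e0.
move/(vcvgP hC)/(_ e e0): yl; apply: filterS => m.
by rewrite -opprD (absN hC).
Qed.

Lemma abs_carlitz_exp z : exp_ball z -> v (expC z) = v z.
Proof.
move=> /exp_ballP[_ ez]; have [z0|z0] := eqVneq z 0.
  apply/eqP; rewrite z0 (abs0 hC) eq_le v_ge0 andbT -[expC 0]subr0.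
  by move: ez; rewrite z0 (abs0 hC) mul0r.
have vz : 0 < v z by rewrite (abs_gt0 hC).
rewrite -[in LHS](subrK z (expC z)) (absD_eq hC) // (le_lt_trans ez) //.
by rewrite ltr_pdivrMr // ltr_pMr.
Qed.

Lemma carlitz_exp_surj y : exp_ball y -> exists2 z, v z <= v y & expC z = y.
Proof.
(* Fixed-point iteration for [z = y - (exp z - z)], contracting by [1/q]. *)
move=> hy; pose T z := y - (expC z - z); pose f m := iter m T y.
have fT m : f m.+1 = T (f m) by [].
have vf m : v (f m) <= v y.
  elim: m => [//|m IHm]; rewrite fT /T (absD_le hC) // (absN hC).
  have [_ h] := exp_ballP (exp_ball_le hy IHm); apply: le_trans h (le_trans _ IHm).
  by rewrite ler_pdivrMr // ler_peMr // ltW.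
have bf m : exp_ball (f m) by apply: exp_ball_le (vf m).
have fS m : v (f m.+1 - f m) <= v y * q%:R ^- m.
  elim: m => [|m IHm].
    rewrite expr0 divr1 (absD_le hC) ?(absN hC) //; exact: (vf 1).
  (* By additivity the new increment is, up to sign, exp d - d for the previous increment d, which
     gains a factor 1/q. *)
  have -> : f m.+2 - f m.+1 =
      - (expC (f m.+1 - f m) - (f m.+1 - f m)).
    by rewrite (carlitz_expB (bf _) (bf _)) [in LHS]fT [in X in _ - X]fT /T; ring.
  have bd : exp_ball (f m.+1 - f m).
    by apply: (exp_ball_le hy); rewrite (absD_le hC) ?(absN hC).
  have [_ h] := exp_ballP bd; rewrite (absN hC) (le_trans h) //.
  by rewrite exprSr invfM mulrA ler_wpM2r // invr_ge0 ltW.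
have [|z fz zf] := @vcvg_geometric _ _ _ _ _ hC f (v y).
  by move=> N m; apply: (abs_telescope hC) => // i _; apply: fS.
have zy : v z <= v y.
  rewrite -(subrK (f 0) z) (absD_le hC) //.
  by have := zf 0; rewrite expr0 divr1.
exists z => //; apply/eqP; rewrite -subr_eq0 -(abs_eq0 hC); apply/negPn/negP => d0.
have d_gt0 : 0 < v (expC z - y) by rewrite lt_def d0 v_ge0.
have [N KN] := geometric_lt F (v y) d_gt0.
suff : v (expC z - y) < v (expC z - y) by rewrite ltxx.
(* Since exp(f N) is y minus the increment at N, both terms are at most v y times q^-N, for a
   suitable N less than the supposed positive distance. *)
have {1}-> : expC z - y = expC (z - f N) - (f N.+1 - f N).
  by rewrite (carlitz_expB (exp_ball_le hy zy) (bf _)) fT /T; ring.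
rewrite (absD_lt hC) ?(absN hC) ?(le_lt_trans (fS _)) //.
rewrite abs_carlitz_exp ?(le_lt_trans (zf _)) //.
by apply: (exp_ball_le hy); rewrite (absD_le hC) ?(absN hC).
Qed.

(** A series with the single coefficient c. Monomials are enough for the equation X^(q-1) + theta =
    0, whose coefficients are 0, 1 and theta. *)
Lemma Kinfty_iota (c : F) N : Kinfty iota v (iota (c *: 'X^N)).
Proof.
exists N, (fun i => if i == 0%N then c else 0).
apply/(vcvgP hC) => e e0; exists 1%N => // -[//|m] _ /=.
rewrite big_ord_recl /= expr0 divr1 big1 => [|i _]; last first.
  by rewrite polyC0 rmorph0 mul0r.
by rewrite addr0 -mul_polyC rmorphM rmorphXn mulrC subrr (abs0 hC).
Qed.

Lemma Kinfty_alg_iota (c : F) N : Kinfty_alg iota v (iota (c *: 'X^N)).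
Proof.
exists ('X - (iota (c *: 'X^N))%:P); split; first by rewrite polyXsubC_eq0.
  case=> [|[|i]]; rewrite coefB coefX coefC /=.
  - by rewrite sub0r -rmorphN -scaleNr; apply: Kinfty_iota.
  - by rewrite subr0 -(rmorph1 iota) -[1]scale1r -(expr0 'X); apply: Kinfty_iota.
  - by rewrite subr0 mulr0n -(rmorph0 iota) -(scale0r 'X^0); apply: Kinfty_iota.
by rewrite root_XsubC.
Qed.

Lemma carlitz_exp_root : exists z,
  [/\ z != 0, expC z = 0 & v z ^+ q.-1 <= q%:R ^+ q].
Proof.
have q'_gt0 : (0 < q.-1)%N by rewrite -subn1 subn_gt0.
have [|i|y _] := @Cinfty_closed _ _ _ _ _ hC ('X^(q.-1) - (- theta)%:P).
- by rewrite size_XnsubC.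
- rewrite coefB coefXn coefC; case: i => [|i] /=.
    rewrite ltn_eqF // sub0r opprK.
    have -> : 'X = 1 *: 'X^1 :> {poly F} by rewrite scale1r expr1.
    exact: Kinfty_alg_iota.
  rewrite subr0; case: eqP => _; last first.
    by rewrite mulr0n -(rmorph0 iota) -(scale0r 'X^0); apply: Kinfty_alg_iota.
  by rewrite mulr1n -(rmorph1 iota) -[1]scale1r -(expr0 'X); apply: Kinfty_alg_iota.
rewrite /root !hornerE subr_eq0 => /eqP yE.
have vy : v y ^+ q.-1 = q%:R by rewrite -(absX hC) yE (absN hC) (Cinfty_theta hC).
have by_ : exp_ball y by rewrite /exp_ball /= vy.
have [z zy ez] := carlitz_exp_surj by_.
have bz := exp_ball_le by_ zy.
have vz : v z = v y by rewrite -(abs_carlitz_exp bz) ez.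
exists (theta * z); split.
- rewrite -(abs_gt0 hC) vM (Cinfty_theta hC) mulr_gt0 // vz (abs_gt0 hC).
  apply/eqP => y0; move: vy; rewrite y0 (abs0 hC) expr0n gtn_eqF //.
  by move=> /esym/eqP; rewrite gt_eqF.
(* exp(theta z) = C_theta(y) = y (theta + y^(q-1)) = 0. *)
- have [zl _] := exp_ballP bz.
  apply: (vlimE hC); have := vcvg_exp_psum_mul 'X zl; rewrite ez.
  rewrite -[X in carlitz_eval _ X _]mulr1 carlitz_evalXM carlitz_eval1.
  by rewrite -[X in y ^+ X](prednK (ltnW q_gt1)) exprSr yE mulNr subrr.
- rewrite vM (Cinfty_theta hC) exprMn vz vy -exprSr prednK //.
  exact: ltnW.
Qed.

(** * Size of the period and of the torsion points *)

Section Period.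
Variable pi_ : C.
Hypothesis hpi : is_carlitz_period iota v pi_.

(** The zero just found is [pi_] times a nonzero a, and v(a) >= 1. *)
Lemma abs_period_le : v pi_ ^+ q.-1 <= q%:R ^+ q.
Proof.
have [z [z0 ez vz]] := carlitz_exp_root.
have [a zE] := (hpi z).1 ez.
have a0 : a != 0 by apply/eqP => a0; rewrite zE a0 rmorph0 mulr0 eqxx in z0.
apply: le_trans vz; rewrite zE lerXn2r ?nnegrE //.
by rewrite vM (abs_iota hC) // ler_peMr // exprn_ege1 // ltW.
Qed.

(** As v(a / n) <= 1/q, the (q-1)-st power is at most q^q / q^(q-1) = q. *)
Lemma exp_ball_torsion a n : (deg a < deg n)%N -> exp_ball (iota a * (pi_ / iota n)).
Proof.
move=> an; have n0 : n != 0 by apply: contraTneq an => ->; rewrite /deg size_poly0.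
rewrite /exp_ball /= !vM (absV hC) (abs_iota hC n0).
have va : v (iota a) <= q%:R ^+ (deg n).-1.
  have [->|a0] := eqVneq a 0; first by rewrite rmorph0 (abs0 hC) exprn_ge0 ?ler0n.
  by rewrite (abs_iota hC) // ler_eXn2l // -ltnS prednK // (leq_trans _ an).
have va' : v (iota a) / q%:R ^+ deg n <= q%:R^-1.
  rewrite ler_pdivrMr ?exprn_gt0 // (le_trans va) //.
  by rewrite -[X in _ <= _ * _ ^+ X](@prednK (deg n)) ?(leq_trans _ an) // exprS mulKf // gt_eqF.
rewrite mulrCA exprMn.
apply: (@le_trans _ _ (q%:R ^+ q * q%:R^-1 ^+ q.-1)).
  rewrite ler_pM ?exprn_ge0 ?divr_ge0 ?exprn_ge0 ?ler0n ?abs_period_le //.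
  by rewrite lerXn2r ?nnegrE ?divr_ge0 ?exprn_ge0 ?invr_ge0 ?ler0n.
rewrite -[X in q%:R ^+ X * _](prednK (ltnW q_gt1)) exprS exprVn -mulrA divff ?mulr1 //.
by rewrite expf_neq0 // gt_eqF.
Qed.

Lemma exp_ball_torsion1 n : (0 < deg n)%N -> exp_ball (pi_ / iota n).
Proof.
move=> n0; have := @exp_ball_torsion 1 n; rewrite rmorph1 mul1r; apply.
by rewrite /deg size_poly1.
Qed.

Lemma abs_lambda n : (0 < deg n)%N ->
  v (expC (pi_ / iota n)) = v pi_ * q%:R ^- deg n.
Proof.
move=> n_gt0; have n0 : n != 0.
  by apply: contraTneq n_gt0 => ->; rewrite /deg size_poly0.
by rewrite (abs_carlitz_exp (exp_ball_torsion1 n_gt0)) vM (absV hC) (abs_iota hC).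
Qed.

Lemma abs_bracket a n : (deg a < deg n)%N ->
  v (bracket iota a (expC (pi_ / iota n))) = v (iota a).
Proof.
move=> an; have n_gt0 : (0 < deg n)%N by apply: leq_ltn_trans an.
have vl := abs_lambda n_gt0; rewrite /bracket; case: eqP => // /eqP l0.
have bn := exp_ball_torsion1 n_gt0; have [nl _] := exp_ballP bn.
rewrite vM (absV hC) -(vlimE hC (vcvg_exp_psum_mul a nl)).
rewrite (abs_carlitz_exp (exp_ball_torsion an)) vM (abs_carlitz_exp bn) mulfK //.
by rewrite -(abs_carlitz_exp bn) (abs_eq0 hC).
Qed.

End Period.
End Exponential.

(** * Uniform bounds and the limit *)

Section Limit.
Variables (F : finFieldType) (R : realType) (C : fieldType).
Variables (iota : {rmorphism {poly F} -> C}) (v : C -> R).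
Hypothesis hC : is_Cinfty iota v.
Implicit Types (a b n : {poly F}) (u : C) (s : seq int).
Local Notation q := #|F|.

Let v_ge0 x : 0 <= v x := Cinfty_ge0 hC x.
Let vM x y : v (x * y) = v x * v y := Cinfty_mul hC x y.
Let qR_gt1 : 1 < q%:R :> R. Proof. by rewrite ltr1n finNzRing_gt1. Qed.
Let qR_gt0 : 0 < q%:R :> R. Proof. exact: lt_trans qR_gt1. Qed.

(** * Nested sums whose factors decay geometrically *)

Section NestedSum.
Variables (f : nat -> int -> C) (M : int -> R) (L : nat).
Hypothesis M_ge0 : forall k, 0 <= M k.
(** The range d < L reflects that the brackets at lambda_n are controlled below degree deg n. *)
Hypothesis fM : forall d k, (d < L)%N -> v (f d k) <= M k * q%:R ^- d.

Lemma abs_nested_sum_le s D : (D <= L)%N ->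
  v (nested_sum f D s) <= \prod_(k <- s) M k.
Proof.
elim: s D => [|k s IHs] D DL; first by rewrite big_nil (abs1 hC).
rewrite big_cons /= (abs_sum_le hC) ?mulr_ge0 ?prodr_ge0 // => i _.
have iL := leq_trans (ltn_ord i) DL.
rewrite vM ler_pM ?IHs ?(ltnW iL) // (le_trans (fM k iL)) //.
by rewrite ler_pdivrMr ?exprn_gt0 // ler_peMr // exprn_ege1 // ltW.
Qed.

(** Raising the bound from i to i + 1 adds only the terms with d_1 = i, whose first factor brings
    q^-i; these increments telescope. *)
Lemma abs_nested_sum_tail s N D : (N <= D <= L)%N ->
  v (nested_sum f D s - nested_sum f N s) <= \prod_(k <- s) M k * q%:R ^- N.
Proof.
move=> /andP[ND DL]; apply: (abs_telescope hC (f := nested_sum f ^~ s)) => //.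
  by rewrite prodr_ge0.
move=> i /andP[_ iD]; have iL := leq_trans iD DL.
case: s => [|k s] /=.
  by rewrite subrr (abs0 hC) divr_ge0 ?exprn_ge0 ?prodr_ge0 // ltW.
rewrite big_ord_recr /= addrC addrK vM big_cons mulrAC.
by rewrite ler_pM ?fM // abs_nested_sum_le // ltnW.
Qed.

End NestedSum.

(** For k = -m <= 0 and d <= m the terms have size q^(d m), and d m + d <= m (m + 1); in the other
    cases a constant >= 1 suffices. *)
Definition bracket_sum_cst (k : int) : R := q%:R ^+ (`|k| * `|k|.+1).

Lemma bracket_sum_cst_ge0 k : 0 <= bracket_sum_cst k.
Proof. by rewrite exprn_ge0 // ltW. Qed.

Lemma abs_monic_sum_le d (f : {poly F} -> C) (e : R) : 0 <= e ->
  (forall a, a \is monic -> size a = d.+1 -> v (f a) <= e) -> v (monic_sum d f) <= e.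
Proof.
by move=> e0 fe; rewrite (abs_sum_le hC) // => a /andP[am /eqP sa]; apply: fe.
Qed.

Lemma abs_bracket_sum_le u L :
  (forall a, (deg a < L)%N -> v (bracket iota a u) = v (iota a)) ->
  forall d k, (d < L)%N ->
    v (bracket_sum iota u d k) <= bracket_sum_cst k * q%:R ^- d.
Proof.
move=> vL d k dL.
have B_ge0 m : 0 <= bracket_sum_cst m * q%:R ^- d.
  by rewrite divr_ge0 ?bracket_sum_cst_ge0 ?exprn_ge0 ?ler0n.
have va a : a \is monic -> size a = d.+1 -> v (bracket iota a u) = q%:R ^+ d.
  move=> am sa; have da : deg a = d by rewrite /deg sa.
  by rewrite vL ?da // (abs_iota hC) ?monic_neq0 // da.
have nonneg (m : nat) :
    v (monic_sum d (fun a => bracket iota a u ^+ m)) <= bracket_sum_cst m * q%:R ^- d.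
  have [md|dm] := ltnP m d; first by rewrite monic_sum_bracket_vanish // (abs0 hC).
  apply: abs_monic_sum_le => // a am sa; rewrite (absX hC) va // /bracket_sum_cst.
  rewrite ler_pdivlMr ?exprn_gt0 // -exprM -exprD ler_eXn2l // -mulnSr.
  by rewrite absz_nat leq_mul.
(* For k = m + 1 the terms have size q^(-d (m + 1)) <= q^-d; for k <= 0 the power is a natural one
   and [nonneg] applies. *)
rewrite /bracket_sum; case: k => [[|m]|m]; first exact: (nonneg 0).
  apply: abs_monic_sum_le => // a am sa.
  have -> : - Posz m.+1 = Negz m by [].
  rewrite /exprz (absV hC) (absX hC) va // -exprM.
  rewrite -[X in X <= _]mul1r ler_pM ?invr_ge0 ?exprn_ge0 ?ler0n //.
    by rewrite exprn_ege1 // ltW.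
  by rewrite lef_pV2 ?posrE ?exprn_gt0 // ler_eXn2l // leq_pmulr.
exact: (nonneg m.+1).
Qed.

Section Continuity.
Context {T : Type} {G : set_system T} {FG : Filter G}.
Variable u : T -> C.
Hypothesis u0 : vcvg v u G 0.

(** Horner induction through theta [a] + u^(q-1) [a]^q + c, whose middle term tends to 0 with u. *)
Lemma vcvg_bracket a : vcvg v (fun t => bracket iota a (u t)) G (iota a).
Proof.
elim/poly_ind: a => [|a c IHa].
  have -> : (fun t => bracket iota 0 (u t)) = fun=> 0.
    by apply/funext => t; rewrite -(scale0r 1) bracketZ rmorph0 mul0r.
  by rewrite rmorph0; apply: (vcvg_cst hC).
rewrite rmorphD [a * _]mulrC rmorphM.
rewrite (_ : (fun t => _) = fun t => (iota 'X * bracket iota a (u t) +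
  u t ^+ q.-1 * bracket iota a (u t) ^+ q) + iota c%:P); last first.
  by apply/funext => t; rewrite bracketD bracketXM -[c%:P]alg_polyC bracketZ bracket1 mulr1 alg_polyC.
apply: (vcvgD hC); last exact: (vcvg_cst hC).
rewrite -[X in vcvg _ _ _ X]addr0; apply: (vcvgD hC).
  by apply: (vcvgM hC) => //; apply: (vcvg_cst hC).
have -> : 0 = 0 ^+ q.-1 * iota a ^+ q :> C.
  by rewrite expr0n -subn1 subn_eq0 leqNgt finNzRing_gt1 mul0r.
by apply: (vcvgM hC); apply: (vcvgX hC).
Qed.

Lemma vcvg_bracket_sum d k :
  vcvg v (fun t => bracket_sum iota (u t) d k) G (bracket_sum iota 0 d k).
Proof.
apply: (vcvg_sum hC) => a /andP[am _]; rewrite bracket0.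
apply: (vcvg_expz hC); last exact: vcvg_bracket.
by rewrite (iota_eq0 hC) monic_neq0.
Qed.

Lemma vcvg_nested_bracket_sum D s :
  vcvg v (fun t => nested_sum (bracket_sum iota (u t)) D s) G
    (nested_sum (bracket_sum iota 0) D s).
Proof.
elim: s D => [|k s IHs] D /=; first exact: (vcvg_cst hC).
apply: (vcvg_sum hC) => i _; apply: (vcvgM hC) => //; exact: vcvg_bracket_sum.
Qed.

End Continuity.

(** Places both sides of the limit in one family of nested sums indexed by u, with u = 0 for the
    zeta value. *)
Lemma S_ltE D s : S_lt iota D s = nested_sum (bracket_sum iota 0) D s.
Proof.
rewrite /S_lt multi_sumE; congr nested_sum; apply/funext => d; apply/funext => k.
by apply: eq_bigr => a _; rewrite bracket0.
Qed.

End Limit.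

Theorem theorem3p18 (F : finFieldType) (R : realType) (C : fieldType)
  (iota : {rmorphism {poly F} -> C}) (v : C -> R) (hC : is_Cinfty iota v)
  (pi_ : C) (hpi : is_carlitz_period iota v pi_) (s : seq int) :
  vcvg v
    (fun n : {poly F} => H_lt iota (deg n) s (carlitz_exp iota v (pi_ / iota n)))
    (@monic_deg_infty F) (zetaA iota v s).
Proof.
have FG := monic_deg_infty_proper F.
have qR_gt0 : 0 < #|F|%:R :> R by rewrite ltr0n ltnW // finNzRing_gt1.
pose u n := carlitz_exp iota v (pi_ / iota n).
pose K : R := \prod_(k <- s) bracket_sum_cst F R k.
(* [K] is independent of [w]: the bound serves w = 0 with any range, and w = lambda_n with L = deg
   n. *)
have tail w L N D : (forall a, (deg a < L)%N -> v (bracket iota a w) = v (iota a)) ->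
    (N <= D <= L)%N ->
    v (nested_sum (bracket_sum iota w) D s - nested_sum (bracket_sum iota w) N s)
      <= K * #|F|%:R ^- N.
  move=> wL; apply: (abs_nested_sum_tail hC) => [k|]; first exact: bracket_sum_cst_ge0.
  exact: (abs_bracket_sum_le hC wL).
have [|z Sz zN] := vcvg_geometric hC (f := fun D => S_lt iota D s) (K := K).
  move=> N D ND; rewrite !S_ltE; apply: (tail _ D); last by rewrite ND leqnn.
  by move=> a _; rewrite bracket0.
rewrite /zetaA (vlimE hC Sz).
have u0 : vcvg v u (@monic_deg_infty F) 0.
  apply/(vcvgP hC) => e e0; have [N KN] := geometric_lt F (v pi_) e0.
  (* [N.+1] forces deg n > 0, as the formula for v(lambda_n) demands. *)
  exists N.+1 => // n /= [_ Nn]; rewrite subr0 /u (abs_lambda hC hpi); last first.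
    exact: leq_trans Nn.
  apply: le_lt_trans KN; rewrite ler_wpM2l ?(Cinfty_ge0 hC) //.
  rewrite lef_pV2 ?posrE ?exprn_gt0 // ler_eXn2l ?ltr1n ?finNzRing_gt1 //.
  exact: ltnW.
apply/(vcvgP hC) => e e0; have [N KN] := geometric_lt F K e0.
have HN := (vcvgP hC _ _).1 (vcvg_nested_bracket_sum hC u0 N s) e e0.
have degN : (@monic_deg_infty F) [set n | n \is monic /\ (N <= deg n)%N] by exists N.
near=> n.
have hn : v (nested_sum (bracket_sum iota (u n)) N s -
    nested_sum (bracket_sum iota 0) N s) < e by near: n; exact: HN.
have [_ Nn] : n \is monic /\ (N <= deg n)%N by near: n; exact: degN.
rewrite /H_lt multi_sumE -/(u n).
set H := nested_sum (bracket_sum iota (u n)) in hn *.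
(* Three errors: the tail of H beyond N, the passage to u = 0 at fixed N, and the tail of the zeta
   value. The tails are small by the choice of N from e alone. *)
have -> : H (deg n) s - z = (H (deg n) s - H N s) +
    ((H N s - nested_sum (bracket_sum iota 0) N s) - (z - S_lt iota N s)).
  by rewrite S_ltE; ring.
apply: (absD_lt hC); last first.
  by apply: (absD_lt hC) => //; rewrite (absN hC) (le_lt_trans (zN N)).
apply: le_lt_trans KN; apply: (tail (u n) (deg n)); last by rewrite Nn leqnn.
by move=> a; apply: abs_bracket.
Unshelve. all: by end_near.
Qed.
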